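(* Consider the noise-free system with actuator failures described in the context, with safe region $\mathcal C=\{x:h(x)\ge0\}$ and failure patterns $\mathcal L=\{L_1,\ldots,L_m\}$. Suppose that for each $j\in\{1,\ldots,m\}$ there exists a relative degree $d'_j$ such that $\frac{\partial h_j^{d'_j}}{\partial x}g(x_t)L_j\ne0$. Let $x_0\in\overline{\mathcal C}:=\bigcap_{j=1}^m\bigcap_{d=0}^{d'_j}\mathcal C_j^d$, and suppose that $u_t$ is chosen to satisfy $u_t\in\bigcap_{L_j\in\mathcal L}\Omega_j$, where $$\Omega_j=\left\{u:\frac{\partial h_j^{d'_j}}{\partial x}\left(f(x_t)+g(x_t)L_ju\right)\ge-\alpha(h_j^{d'_j}(x_t))\right\}.$$ Then, when the set $\bigcap_{L_j\in\mathcal L}\Omega_j$ is non-empty (at each time), safety is guaranteed when any failure pattern $L_j\in\mathcal L$ happens, i.e. $x_t\in\mathcal C$ for all $t$.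
   Context: System: $dx_t=(f(x_t)+g(x_t)u^F_t)\,dt$, $dy_t=cx_t\,dt$, $x_t\in\mathbb R^n$, $u_t\in\mathbb R^p$, $f,g$ locally Lipschitz, where the actuator output under failure is $u^F_t=Lu_t$ with $L$ a $p\times p$ diagonal matrix, $L_{ii}=0$ if actuator $i$ is in the failed set $\mathcal I$ and $L_{ii}=1$ otherwise. $h$ is twice differentiable on $\mathcal C$. The set of failure patterns is $\mathcal L=\{L_{\mathcal I}:\mathcal I\subsetneq\{1,\ldots,p\},\ |\mathcal I|\le r\}=\{L_1,\ldots,L_m\}$, and the system is assumed to have $r$ actuator redundancy, i.e. it remains controllable for all failure patterns in $\mathcal L$. The pattern that occurs is unknown. High-order functions for pattern $L_j$: $h_j^0=h$ and $h_j^{d+1}(x)=\frac{\partial h_j^d}{\partial x}(f(x)+g(x)L_ju)+h_j^d(x)$; $\mathcal C_j^d=\{x:h_j^d(x)\ge0\}$. $\alpha$ is the class-$\mathcal K$ function of the control barrier condition. *)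

(* Defs.v *)
From HB Require Import structures.
From mathcomp Require Export all_boot all_order all_algebra.
From mathcomp Require Export all_classical all_reals all_analysis.

Set Implicit Arguments.
Unset Strict Implicit.
Unset Printing Implicit Defensive.

Export Order.TTheory GRing.Theory Num.Theory.
Export numFieldNormedType.Exports.

Local Open Scope classical_set_scope.
Local Open Scope ring_scope.

(* The row vector dh/dx of partial derivatives. *)
Definition grad (R : realType) (n : nat) (h : 'cV[R]_n -> R) (x : 'cV[R]_n)
    : 'rV[R]_n :=
  \row_i 'D_(delta_mx i 0) h x.

Definition twice_differentiable (R : realType) (n : nat) (h : 'cV[R]_n -> R)
    (x : 'cV[R]_n) : Prop :=
  (\forall y \near x, differentiable h y) /\ differentiable (grad h) x.

Definition superlevel (R : realType) (n : nat) (h : 'cV[R]_n -> R)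
    : set 'cV[R]_n :=
  [set x | 0 <= h x].

(* In a barrier condition alpha is evaluated at every h(x_t), whose sign is not
   known beforehand; hence alpha is defined on all of R rather than on
   [0, +oo[ only. *)
Definition class_K (R : realType) (alpha : R -> R) : Prop :=
  [/\ continuous alpha, {homo alpha : s t / s < t} & alpha 0 = 0].

(* dz_t = v_t dt on [0, T] in the sense of Caratheodory: z is a Lebesgue
   primitive of v, so discontinuous inputs are allowed. *)
Definition solves_dt (R : realType) (k : nat) (T : R) (v z : R -> 'cV[R]_k)
    : Prop :=
  forall i : 'I_k,
    (@lebesgue_measure R).-integrable `[0, T] (fun s => (v s i 0)%:E) /\
    forall t, 0 <= t <= T ->
      z t i 0 = z 0 i 0 + \int[lebesgue_measure]_(s in `[0, t]) (v s i 0).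

Section FaultySystem.
Variables (R : realType) (n p q : nat).
Variables (f : 'cV[R]_n -> 'cV[R]_n) (g : 'cV[R]_n -> 'M[R]_(n, p)).
Variable c : 'M[R]_(q, n).

(* The right-hand side f(x) + g(x) u^F with u^F = L u. *)
Definition vfield (L : 'M[R]_p) (x : 'cV[R]_n) (u : 'cV[R]_p) : 'cV[R]_n :=
  f x + g x *m (L *m u).

Definition state_trajectory (L : 'M[R]_p) (T : R) (u : R -> 'cV[R]_p)
    (x : R -> 'cV[R]_n) : Prop :=
  solves_dt T (fun s => vfield L (x s) (u s)) x.

Definition trajectory (L : 'M[R]_p) (T : R) (u : R -> 'cV[R]_p)
    (x : R -> 'cV[R]_n) (y : R -> 'cV[R]_q) : Prop :=
  state_trajectory L T u x /\ solves_dt T (fun s => c *m x s) y.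

Definition pattern (I : {set 'I_p}) : 'M[R]_p :=
  diag_mx (\row_i (i \notin I)%:R).

Definition failure_patterns (r : nat) : set 'M[R]_p :=
  [set pattern I | I in [set I : {set 'I_p} |
     (I \proper [set: 'I_p]) && (#|I| <= r)%N]].

Definition controllable (L : 'M[R]_p) : Prop :=
  forall a b : 'cV[R]_n, exists (T : R) (u : R -> 'cV[R]_p)
      (x : R -> 'cV[R]_n),
    [/\ 0 <= T, state_trajectory L T u x, x 0 = a & x T = b].

Definition actuator_redundancy (r : nat) : Prop :=
  forall L, failure_patterns r L -> controllable L.

(* h^0, ..., h^d' are the high-order functions of h under the pattern L:
   h^{d+1}(x) = dh^d/dx (f(x) + g(x) L u) + h^d(x).  As h^{d+1} is a function
   of x alone, the formula holds for every u; it is only imposed where dh^d/dx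
   exists, [grad] having junk values elsewhere. *)
Definition high_order_functions (L : 'M[R]_p) (h : 'cV[R]_n -> R) (d' : nat)
    (hd : nat -> 'cV[R]_n -> R) : Prop :=
  hd 0%N = h /\
  forall d, (d < d')%N -> forall x, differentiable (hd d) x ->
    forall u, hd d.+1 x = (grad (hd d) x *m vfield L x u) 0 0 + hd d x.

(* At x, the derivatives of h^0, ..., h^d' exist and the first of these
   functions whose derivative along the flow is affected by the input is
   h^d'. *)
Definition relative_degree (L : 'M[R]_p) (hd : nat -> 'cV[R]_n -> R)
    (d' : nat) (x : 'cV[R]_n) : Prop :=
  [/\ forall d, (d <= d')%N -> differentiable (hd d) x,
      forall d, (d < d')%N -> grad (hd d) x *m g x *m L = 0
    & grad (hd d') x *m g x *m L != 0].

(* The inputs satisfying the barrier condition of b at x under L. *)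
Definition Omega (L : 'M[R]_p) (alpha : R -> R) (b : 'cV[R]_n -> R)
    (x : 'cV[R]_n) : set 'cV[R]_p :=
  [set u | (grad b x *m vfield L x u) 0 0 >= - alpha (b x)].

End FaultySystem.

Arguments failure_patterns {R} p r.

(* Main.v *)
Require Import Defs.
From mathcomp Require Import measurable_realfun lra.

(* Only the pattern L_k that occurs matters.  Along the trajectory the
   functions b = h^d satisfy (b o x)' > 0 at almost every time where b o x < 0:
   for d = d' by the barrier condition, and for d < d' because
   (h^d o x)' = h^{d+1} o x - h^d o x once h^{d+1} o x >= 0 is known.  So a
   descending induction on d reduces everything to one comparison principle.

   As b is only assumed differentiable at each point of the curve, b o x need
   not be absolutely continuous, but it is bounded by a pointwise Lipschitz
   estimate |b(x_s) - b(x_t)| <= C_t |x_s - x_t| <= C_t int_t^s f, where f is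
   integrable.  On the null set Z of exceptional times this is compensated by a
   nondecreasing function phi of arbitrarily small variation whose growth to the
   right of each point of Z dominates every multiple of int f: then b o x + phi
   is locally nondecreasing to the right at every time. *)

Set Implicit Arguments.
Unset Strict Implicit.
Unset Printing Implicit Defensive.

Local Open Scope classical_set_scope.
Local Open Scope ring_scope.

Local Notation mu := lebesgue_measure.

(** * Monotonicity from growth to the right *)

(** Otherwise let [c] be the infimum of the times where [w + phi] is below its value at [a]. The
    bound still holds at [c], hence just after [c] by the hypothesis to the right, which contradicts
    the choice of [c]. The jumps of [phi] only go upwards. *)
Lemma le_near_right (R : realType) (w phi : R -> R) (a b : R) :
  continuous w -> {homo phi : s t / s <= t} -> a <= b ->
  (forall t, a <= t < b -> \forall s \near t^'+, w t + phi t <= w s + phi s) ->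
  w a + phi a <= w b + phi b.
Proof.
move=> cw phi_nd ab wphi; rewrite leNgt; apply/negP => Fba.
pose B := [set t | a <= t <= b /\ w t + phi t < w a + phi a].
have Bb : B b by rewrite /B /= ab lexx.
have Blb : lbound B a by move=> t [/andP[]].
have hB : has_inf B by split; [exists b|exists a].
set c := inf B.
have ac : a <= c by apply: lb_le_inf => //; exists b.
have cb : c <= b by apply: ge_inf => //; exists a.
have below s : a <= s -> s < c -> w a + phi a <= w s + phi s.
  move=> as_ sc; rewrite leNgt; apply/negP => Fs.
  have : B s by split=> //; rewrite as_ (le_trans (ltW sc) cb).
  by move/(ge_inf hB.2); rewrite leNgt sc.
(* A drop at [c] would already show at some [s < c]: [w] is continuous from the left and
   [phi s <= phi c]. *)
have Fc : w a + phi a <= w c + phi c.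
  move: ac; rewrite le_eqVlt => /predU1P[<-//|ac].
  rewrite leNgt; apply/negP; rewrite -ltrBrDr => wc.
  have wcl : w s @[s --> c^'-] --> w c by apply: cvg_at_left_filter; exact: cw.
  have [s [as_ sc ws]] :
      exists s, [/\ a <= s, s < c & w s < w a + phi a - phi c].
    near c^'- => s; exists s; split.
    - by apply: ltW; near: s; exact: nbhs_left_gt.
    - by near: s; exact: nbhs_left_lt.
    - by near: s; exact: cvgr_lt wc.
  have := below _ as_ sc; rewrite leNgt => /negP; apply.
  rewrite (le_lt_trans _ (_ : w s + phi c < _)) ?lerD2l ?phi_nd 1?ltW//.
  by rewrite -ltrBrDr.
have cltb : c < b.
  rewrite lt_neqAle cb andbT; apply/eqP => cE.
  by move: Fc; rewrite cE leNgt Fba.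
have [e e0 He] : exists2 e, 0 < e &
    forall s, c < s < c + e -> w c + phi c <= w s + phi s.
  have /nbhs_ballP[e /= e0 He] :
      \forall s \near c^'+, w c + phi c <= w s + phi s.
    by apply: wphi; rewrite ac.
  exists e => // s /andP[cs sce]; apply: He => //.
  by rewrite /ball/= distrC gtr0_norm ?subr_gt0// ltrBlDl.
have [s Bs sce] := inf_adherent e0 hB.
have cs : c <= s by apply: ge_inf => //; exists a.
have [_ ] := Bs; rewrite ltNge => /negP; apply.
move: cs; rewrite le_eqVlt => /predU1P[<-//|cs].
by apply: le_trans Fc _; apply: He; rewrite cs.
Unshelve. all: by end_near. Qed.

(** * Penalty functions for null sets *)

(** Outer regularity gives an open cover of small measure, on which absolute continuity makes the
    integral small. *)
Lemma negligible_open_cover (R : realType) (f : R -> R) (Z : set R) (e : R) :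
  (forall x, 0 <= f x) -> mu.-integrable setT (EFin \o f) ->
  mu.-negligible Z -> 0 < e ->
  exists O : set R, [/\ open O, Z `<=` O &
    (\int[mu]_(x in O) (f x)%:E <= e%:E)%E].
Proof.
move=> f0 intf [N [mN N0 ZN]] e0.
have [d [d0 Hd]] := integral_normr_continuous intf e0.
have [|O [oO NO Od]] := lebesgue_regularity_outer mN _ d0.
  by rewrite [ltLHS]N0 ltry.
have mO : measurable O by exact: open_measurable.
exists O; split=> //; first exact: subset_trans NO.
have Omu : (mu O < d%:E)%E.
  rewrite -(setDUK NO) measureU//; [|exact: measurableD|exact: setDIK].
  by rewrite [X in (X + _)%E]N0 add0e.
have := Hd O mO Omu.
under eq_Rintegral do rewrite ger0_norm ?f0//.
rewrite /Rintegral -lte_fin fineK; first exact: ltW.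
by apply: integrable_fin_num => //; apply: integrableS intf.
Qed.

(* phi is the distribution function of the measure
   sum_n (f dt restricted to U_n), where U_n is an open neighbourhood of Z with
   int_(U_n) f <= e / 2^(n+1); near a point of Z, an interval lies in as many
   U_n as desired. *)
Lemma negligible_penalty (R : realType) (f : R -> R) (Z : set R) (e : R) :
  (forall x, 0 <= f x) -> mu.-integrable setT (EFin \o f) ->
  mu.-negligible Z -> 0 < e ->
  exists phi : R -> R, [/\ {homo phi : s t / s <= t},
    forall s t, phi t - phi s <= e &
    forall t C, Z t -> \forall s \near t^'+,
      C * \int[mu]_(x in `]t, s]) f x <= phi s - phi t].
Proof.
move=> f0 intf Z0 e0.
have en0 n : 0 < e / (2 ^ n.+1)%:R by rewrite divr_gt0.
have /choice[U HU] := fun n => negligible_open_cover f0 intf Z0 (en0 n).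
have mU n : measurable (U n : set (measurableTypeR R)).
  by apply: open_measurable; case: (HU n).
pose nu n (A : set R) := (\int[mu]_(x in A `&` U n) (f x)%:E)%E.
pose lambda A := (\sum_(0 <= n <oo) nu n A)%E.
have mf (A : set (measurableTypeR R)) :
    measurable A -> measurable_fun A (EFin \o f).
  by move=> mA; apply: measurable_funS (measurable_int _ intf).
have nu0 n A : (0 <= nu n A)%E by apply: integral_ge0 => x _; rewrite lee_fin.
have lambda0 A : (0 <= lambda A)%E by exact: nneseries_ge0.
have lambda_le (A : set (measurableTypeR R)) :
    measurable A -> (lambda A <= e%:E)%E.
  move=> mA; apply: le_trans (epsilon_trick0 xpredT (ltW e0)).
  apply: lee_nneseries => // n _; case: (HU n) => _ _; apply: le_trans.
  apply: ge0_subset_integral => //; [exact: measurableI|exact: mf|].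
  by move=> x _; rewrite lee_fin.
have lambdaU : forall A B : set (measurableTypeR R),
    measurable A -> measurable B -> [disjoint A & B] ->
    lambda (A `|` B) = (lambda A + lambda B)%E.
  move=> A B mA mB AB; rewrite /lambda -nneseriesD//; apply: eq_eseriesr => n _.
  rewrite /nu setIUl ge0_integral_setU//=.
  - exact: measurableI.
  - exact: measurableI.
  - by apply: mf; apply: measurableU; exact: measurableI.
  - by move=> x _; rewrite lee_fin.
  - by apply/disj_setPS => x [[Ax _] [Bx _]]; move/disj_setPS: AB; apply.
have lambda_fin (A : set (measurableTypeR R)) :
    measurable A -> lambda A \is a fin_num.
  by move=> mA; rewrite ge0_fin_numE// (le_lt_trans (lambda_le _ mA))// ltry.
pose phi s := fine (lambda `]-oo, s]%classic).
have phiB s t : s <= t -> phi t - phi s = fine (lambda `]s, t]%classic).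
  move=> st; rewrite /phi (_ : `]-oo, t] = `]-oo, s] `|` `]s, t])%classic.
    rewrite lambdaU// ?fineD ?lambda_fin//; first by rewrite addrAC subrr add0r.
    apply/disj_setPS => x /=; rewrite !in_itv/= => -[xs /andP[]].
    by rewrite ltNge xs.
  by rewrite -itv_bndbnd_setU.
have phi_nd : {homo phi : s t / s <= t}.
  by move=> s t st; rewrite -subr_ge0 phiB// fine_ge0.
exists phi; split => //.
- move=> s t; have [st|/ltW ts] := leP s t.
    by rewrite phiB// -lee_fin fineK ?lambda_fin// lambda_le.
  by apply: le_trans (ltW e0); rewrite subr_le0 phi_nd.
(* Once []t, s]] lies in the first [n >= C] sets [U i], each of them contributes the full integral
   of [f] over it to [lambda]. *)
- move=> t C Zt; have [n Cn] : exists n : nat, C <= n%:R.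
    by exists (Num.truncn C).+1; apply: ltW; rewrite truncnS_gt.
  have : \forall s \near t, forall i : 'I_n, U i s.
    apply: (@filter_forall _ _ (fun i : 'I_n => U i) _ (nbhs_filter t)) => i.
    case: (HU i) => oUi ZUi _.
    by apply: open_nbhs_nbhs; split=> //; exact: ZUi.
  move=> /nbhs_ballP[d /= d0 Hd].
  near=> s.
  have ts : t < s by near: s; exact: nbhs_right_gt.
  have sU i : (i < n)%N -> (`]t, s] `<=` U i)%classic.
    move=> ni x /=; rewrite in_itv/= => /andP[tx xs].
    apply: (Hd x _ (Ordinal ni)); rewrite /ball/= distrC gtr0_norm ?subr_gt0//.
    rewrite ltrBlDl (le_lt_trans xs)//; near: s; apply: nbhs_right_lt.
    by rewrite ltrDl.
  have If : (\int[mu]_(x in `]t, s]) (f x)%:E)%E \is a fin_num.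
    by apply: integrable_fin_num => //; apply: integrableS intf.
  rewrite phiB ?(ltW ts)//.
  rewrite (@le_trans _ _ (n%:R * \int[mu]_(x in `]t, s]) f x))//.
    by rewrite ler_wpM2r// Rintegral_ge0.
  rewrite -lee_fin fineK ?lambda_fin//.
  apply: le_trans (nneseries_lim_ge n _) => //.
  rewrite (@eq_big_nat _ _ _ 0 n _ (fun=> (\int[mu]_(x in `]t, s]) f x)%:E)).
    by rewrite sumEFin sumr_const_nat subn0 mulr_natl.
  by move=> i /andP[_ ni]; rewrite /nu setIidl ?fineK//; exact: sU.
Unshelve. all: by end_near. Qed.

(** * Comparison up to a null set of times *)

Lemma le_of_ae_near_right (R : realType) (f w : R -> R) (Z : set R) (a b : R) :
  (forall x, 0 <= f x) -> mu.-integrable setT (EFin \o f) -> mu.-negligible Z ->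
  continuous w ->
  (forall t, exists C, \forall s \near t^'+,
     `|w s - w t| <= C * \int[mu]_(x in `]t, s]) f x) ->
  a <= b ->
  (forall t, a <= t < b -> ~ Z t -> \forall s \near t^'+, w t <= w s) ->
  w a <= w b.
Proof.
move=> f0 intf Z0 cw wf ab wZ; apply/ler_addgt0Pr => e e0.
have [phi [phi_nd phi_e phiZ]] := negligible_penalty f0 intf Z0 e0.
have := phi_e a b; rewrite lerBlDr => phib.
rewrite -(lerD2r (phi a)); apply: le_trans (_ : w b + phi b <= _); last first.
  by rewrite -addrA lerD2l.
apply: le_near_right => // t tab; have [Zt|Zt] := pselect (Z t); last first.
  near=> s; rewrite lerD//; first by near: s; exact: wZ.
  by rewrite phi_nd// ltW//; near: s; exact: nbhs_right_gt.
have [C wC] := wf t; near=> s.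
suff : w t - w s <= phi s - phi t by lra.
rewrite (le_trans (ler_norm _))// distrC.
apply: (@le_trans _ _ (C * \int[mu]_(x in `]t, s]) f x)); first by near: s.
by near: s; exact: phiZ.
Unshelve. all: by end_near. Qed.

(** If [w T < 0], then after the last time [t0] with [w t0 >= 0] the function is negative, hence
    nondecreasing, and cannot descend to [w T]. *)
Lemma ge0_of_ae_near_right (R : realType) (f w : R -> R) (Z : set R) (T : R) :
  (forall x, 0 <= f x) -> mu.-integrable setT (EFin \o f) -> mu.-negligible Z ->
  continuous w ->
  (forall t, exists C, \forall s \near t^'+,
     `|w s - w t| <= C * \int[mu]_(x in `]t, s]) f x) ->
  0 <= T -> 0 <= w 0 ->
  (forall t, 0 < t < T -> ~ Z t -> w t < 0 ->
     \forall s \near t^'+, w t <= w s) ->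
  0 <= w T.
Proof.
move=> f0 intf Z0 cw wf T0 w0 wZ; rewrite leNgt; apply/negP => wT.
pose S := [set t | 0 <= t <= T /\ 0 <= w t].
have S0 : S 0 by split=> //; rewrite lexx.
have hS : has_sup S by split; [exists 0|exists T => t [/andP[]]].
set t0 := sup S.
have t00 : 0 <= t0 by apply: ub_le_sup => //; case: hS.
have t0T : t0 <= T by apply: ge_sup; [exists 0|move=> t [/andP[]]].
have above t : t0 < t -> t <= T -> w t < 0.
  move=> t0t tT; rewrite ltNge; apply/negP => wt.
  have : S t by split=> //; rewrite tT (le_trans t00 (ltW t0t)).
  by move/(ub_le_sup hS.2); rewrite leNgt t0t.
have wt0 : 0 <= w t0.
  rewrite leNgt; apply/negP => wt0.
  have /nbhs_ballP[d /= d0 Hd] : \forall s \near t0, w s < 0.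
    exact: (cvgr_lt (w t0) (cw t0) _ wt0).
  have [s Ss ds] := sup_adherent d0 hS.
  have st0 : s <= t0 by apply: ub_le_sup => //; case: hS.
  have [_] := Ss; rewrite leNgt => /negP; apply; apply: Hd.
  by rewrite /ball/= ger0_norm ?subr_ge0// ltrBlDr -ltrBlDl.
have {}t0T : t0 < T.
  rewrite lt_neqAle t0T andbT; apply/eqP => t0E.
  by move: wt0; rewrite t0E leNgt wT.
have wTt0 : w T < w t0 by rewrite (lt_le_trans wT).
have wr : w s @[s --> t0^'+] --> w t0 by apply: cvg_at_right_filter; exact: cw.
(* Growth is known only where [w < 0], so the comparison starts strictly after [t0]; continuity
   keeps [w a] above [w T]. *)
have [a [t0a aT wa]] : exists a, [/\ t0 < a, a <= T & w T < w a].
  near t0^'+ => a; exists a; split.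
  - by near: a; exact: nbhs_right_gt.
  - by near: a; exact: nbhs_right_le.
  - by near: a; exact: (cvgr_gt (w t0) wr _ wTt0).
move: wa; rewrite ltNge => /negP; apply.
apply: (le_of_ae_near_right f0 intf Z0) => // t /andP[at_ tT] Zt.
have t0t := lt_le_trans t0a at_.
by apply: wZ => //; [rewrite tT (le_lt_trans t00 t0t)|exact: above (ltW tT)].
Unshelve. all: by end_near. Qed.

(** * Local estimates from differentiability *)

Lemma differentiable_pointwise_lipschitz (R : realType) (V W : normedModType R)
    (b : V -> W) (x : V) : differentiable b x ->
  exists2 C, 0 < C & \forall y \near x, `|b y - b x| <= C * `|y - x|.
Proof.
move=> db; have [C C0 HC] := linear_lipschitz (diff_continuous db).
(* [C] bounds the differential; the extra 1 absorbs the little-o remainder. *)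
exists (C + 1); first by rewrite addr_gt0.
have /eqaddoP/(_ _ ltr01) := diff_locally db.
rewrite -(subrr x) -/(shift (- x) x) => H.
have : \forall y \near x, `|b y - b x - 'd b x (y - x)| <= `|y - x|.
  have /nbhs_ballP[e /= e0 He] := H.
  apply/nbhs_ballP; exists e => //= y xy.
  have : ball (x - x) e (y - x) ->
      `|b (y - x + x) - (b x + 'd b x (y - x))| <= 1 * `|y - x| := He (y - x).
  rewrite subrK mul1r opprD addrA; apply.
  by move: xy; rewrite -!ball_normE /ball_/= subrr sub0r opprB.
apply: filterS => y Hy; rewrite mulrDl mul1r.
rewrite -(subrK ('d b x (y - x)) (b y - b x)) (le_trans (ler_normD _ _))//.
by rewrite addrC lerD.
Qed.

Lemma diff_grad (R : realType) (n : nat) (b : 'cV[R]_n -> R) (x v : 'cV[R]_n) :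
  differentiable b x -> 'd b x v = (grad b x *m v) 0 0.
Proof.
move=> db; rewrite mxE {1}(matrix_sum_delta v) linear_sum.
apply: eq_bigr => i _.
by rewrite big_ord1 linearZ /grad mxE deriveE// mulrC.
Qed.

Lemma near_right_lt_of_derive_gt0 (R : realType) (w : R -> R) (t : R) :
  derivable w t 1 -> 0 < 'D_1 w t -> \forall s \near t^'+, w t < w s.
Proof.
move=> dw w0.
have wd : h^-1 *: (w (h *: 1 + t) - w t) @[h --> 0^'] --> 'D_1 w t := dw.
have /nbhs_ballP[e /= e0 He] :
    \forall h \near 0^', 0 < h^-1 *: (w (h *: 1 + t) - w t).
  exact: (cvgr_gt _ wd _ w0).
near=> s.
have ts : t < s by near: s; exact: nbhs_right_gt.
have := He (s - t); rewrite /ball/= sub0r normrN gtr0_norm ?subr_gt0//.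
rewrite scaler1 subrK gt_eqF ?subr_gt0// pmulr_rgt0 ?invr_gt0 ?subr_gt0//.
apply=> //.
rewrite ltrBlDl; near: s; apply: nbhs_right_lt.
by rewrite ltrDl.
Unshelve. all: by end_near. Qed.

(** * Lebesgue primitives and Caratheodory solutions *)

Lemma integral_small_itv (R : realType) (f : R -> R) (e : R) :
  (forall x, 0 <= f x) -> mu.-integrable setT (EFin \o f) -> 0 < e ->
  exists2 d, 0 < d & forall s t, s <= t -> t < s + d ->
    \int[mu]_(x in `]s, t]) f x < e.
Proof.
move=> f0 intf e0; have [d [d0 Hd]] := integral_normr_continuous intf e0.
exists d => // s t st td.
have := Hd `]s, t]%classic; under eq_Rintegral do rewrite ger0_norm ?f0//.
apply; first exact: measurable_itv.
rewrite [ltLHS]lebesgue_measure_itv/=; case: ifPn => _; last by rewrite lte_fin.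
by rewrite -EFinB lte_fin ltrBlDl.
Qed.

(** This identifies a primitive on the whole line with the integral equation at the time clamped to
    [[0, T]]. *)
Lemma Rintegral_restrict_itv (R : realType) (v : R -> R) (T t : R) : 0 <= T ->
  \int[mu]_(s in `]-oo, t]) (v \_ `[0, T]) s =
  \int[mu]_(s in `[0, Num.min T (Num.max 0 t)]) v s.
Proof.
move=> T0; rewrite -Rintegral_mkcondr.
have [t0|t0] := ltP t 0.
  rewrite (_ : _ `&` _ = set0) ?Rintegral_set0; last first.
    by apply/seteqP; split=> x //=; rewrite !in_itv/=; lra.
  by rewrite min_r// set_itv1 Rintegral_set1.
congr (Rintegral _ _ _).
by apply/seteqP; split=> x /=; rewrite !in_itv/= le_min; lra.
Qed.

Lemma ae_derive_primitive (R : realType) (v : R -> R) (T : R) :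
  mu.-integrable `[0, T] (EFin \o v) ->
  let F t := \int[mu]_(s in `]-oo, t]) (v \_ `[0, T]) s in
  {ae mu, forall t, 0 < t < T -> derivable F t 1 /\ 'D_1 F t = v t}.
Proof.
move=> intv F.
have mI : measurable (`[0, T]%classic : set (measurableTypeR R)).
  exact: measurable_itv.
have intf : mu.-integrable setT (EFin \o (v \_ `[0, T])).
  by rewrite -restrict_EFin; exact: (integrable_mkcond _ mI).1.
have : {ae mu, forall t, derivable F t 1 /\ derive1 F t = (v \_ `[0, T]) t}.
  apply: FTC1Ny; last exact: integrable_locally.
  by move=> y; apply: integrableS intf.
apply: filterS; first exact: (ae_filter_ringOfSetsType mu).
move=> t [dF DF] t0T; split=> //.
rewrite -derive1E DF patchE mem_set//= in_itv/=.
by case/andP: t0T => /ltW-> /ltW->.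
Qed.


(* X is z stopped at time T and extended by z 0 to negative times, so that it
   is continuous and pointwise controlled on the whole line. *)
Lemma solves_dt_extend (R : realType) (n : nat) (T : R) (v z : R -> 'cV[R]_n) :
  0 <= T -> solves_dt T v z ->
  exists (X : R -> 'cV[R]_n) (f : R -> R),
    [/\ forall s, 0 <= f s, mu.-integrable setT (EFin \o f),
        forall s t, s <= t -> `|X t - X s| <= \int[mu]_(r in `]s, t]) f r,
        forall t, X t = z (Num.min T (Num.max 0 t))
      & {ae mu, forall t, 0 < t < T -> derivable X t 1 /\ 'D_1 X t = v t}].
Proof.
move=> T0 zv.
pose fi i := (fun s => v s i 0) \_ `[0, T].
pose F i t := \int[mu]_(s in `]-oo, t]) fi i s.
pose X t : 'cV[R]_n := \col_i (z 0 i 0 + F i t).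
(* The sum dominates every coordinate, hence the max norm of the column. *)
pose f t := \sum_i `|fi i t|.
have mI : measurable (`[0, T]%classic : set (measurableTypeR R)).
  exact: measurable_itv.
have intv i : mu.-integrable `[0, T] (EFin \o (fun s => v s i 0)).
  by case: (zv i).
have intf i : mu.-integrable setT (EFin \o fi i).
  by rewrite -restrict_EFin; exact: (integrable_mkcond _ mI).1.
have intnf i : mu.-integrable setT (EFin \o (fun s => `|fi i s|)).
  exact: (integrable_norm (intf i)).
have int_f : mu.-integrable setT (EFin \o f).
  have : mu.-integrable setT (fun s => \sum_i (`|fi i s|)%:E)%E.
    by apply: integrable_sum => // i _; exact: intnf.
  by under eq_fun do rewrite sumEFin.
exists X, f; split => //.
- by move=> s; apply: sumr_ge0.
- move=> s t st; rewrite /Num.norm/= mx_normrE; apply: bigmax_le.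
    by apply: Rintegral_ge0 => x _; apply: sumr_ge0.
  move=> [i j] _ /=; rewrite !mxE opprD addrACA subrr add0r.
  rewrite /F Rintegral_itvB//; last by apply: integrableS (intf i).
  apply: le_trans (le_normr_Rintegral _ _) _ => //.
    by apply: integrableS (intf i).
  apply: le_Rintegral => //.
  + by apply: integrableS (intnf i).
  + by apply: integrableS int_f.
  + by move=> x _; rewrite /f (bigD1 i)//= lerDl sumr_ge0.
- move=> t; apply/colP => i; rewrite mxE /F Rintegral_restrict_itv//.
  have [_ /(_ (Num.min T (Num.max 0 t))) ->//] := zv i.
  by rewrite ge_min lexx le_min T0 le_max lexx.
- have := @filter_forall _ 'I_n (fun i t => 0 < t < T ->
      derivable (F i) t 1 /\ 'D_1 (F i) t = v t i 0) _
      (ae_filter_ringOfSetsType mu) (fun i => ae_derive_primitive (intv i)).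
  apply: filterS; first exact: (ae_filter_ringOfSetsType mu).
  move=> t Ht t0T.
  have dX : derivable X t 1.
    apply/derivable_mxP => i j.
    have [dF _] := Ht i t0T.
    rewrite (_ : (fun _ => _) = cst (z 0 i 0) + F i); first exact: derivableD.
    by apply/funext => x; rewrite mxE.
  split=> //; rewrite derive_mx//; apply/colP => i; rewrite mxE.
  have [dF <-] := Ht i t0T.
  rewrite (_ : (fun _ => _) = cst (z 0 i 0) + F i); last first.
    by apply/funext => x; rewrite mxE.
  by rewrite deriveD// derive_cst add0r.
Qed.

Lemma continuous_of_integral_bound (R : realType) (V : normedModType R)
    (X : R -> V) (f : R -> R) :
  (forall s, 0 <= f s) -> mu.-integrable setT (EFin \o f) ->
  (forall s t, s <= t -> `|X t - X s| <= \int[mu]_(r in `]s, t]) f r) ->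
  continuous X.
Proof.
move=> f0 intf Xf t; apply/cvgrPdist_lt => e e0.
have [d d0 Hd] := integral_small_itv f0 intf e0.
apply/nbhs_ballP; exists d => //= s; rewrite /ball/= ltr_distlC => /andP[ds sd].
have [ts|/ltW st] := leP t s.
  by rewrite distrC (le_lt_trans (Xf _ _ ts))// Hd.
by rewrite (le_lt_trans (Xf _ _ st))// Hd// -ltrBlDr.
Qed.

(** * Forward invariance and safety *)

Lemma superlevel_forward_invariant (R : realType) (n : nat) (T : R)
    (v z : R -> 'cV[R]_n) (b : 'cV[R]_n -> R) :
  0 <= T -> solves_dt T v z ->
  (forall t, 0 <= t <= T -> differentiable b (z t)) ->
  (forall t, 0 < t < T -> b (z t) < 0 -> 0 < (grad b (z t) *m v t) 0 0) ->
  0 <= b (z 0) -> 0 <= b (z T).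
Proof.
move=> T0 zv db bv b0.
have [X [f [f0 intf Xf Xz Xd]]] := solves_dt_extend T0 zv.
have Xin t : 0 <= t <= T -> X t = z t.
  by move=> /andP[t0 tT]; rewrite Xz max_r// min_r.
have dbX t : differentiable b (X t).
  by rewrite Xz; apply: db; rewrite ge_min lexx le_min T0 le_max lexx.
have cX : continuous X := continuous_of_integral_bound f0 intf Xf.
have -> : z T = X T by rewrite Xin// T0 lexx.
(* [Xd] fixes the null set: the times in []0, T[] at which [X] fails to have derivative [v t]. *)
apply: (@ge0_of_ae_near_right _ f (b \o X) _ T f0 intf Xd) => //.
- move=> t; apply: continuous_comp; first exact: cX.
  exact: differentiable_continuous.
- move=> t; have [C C0 HC] := differentiable_pointwise_lipschitz (dbX t).
  exists C.
  have H : \forall s \near t, `|b (X s) - b (X t)| <= C * `|X s - X t|.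
    exact: (cX t _ HC).
  near=> s; have ts : t < s by near: s; exact: nbhs_right_gt.
  rewrite (@le_trans _ _ (C * `|X s - X t|))//.
    by near: s; exact: cvg_within H.
  by rewrite ler_pM2l// Xf// ltW.
- by rewrite /= Xin// lexx T0.
- move=> t t0T /contrapT /(_ t0T)[dX DX] /= bt.
  have zt : X t = z t by case/andP: t0T => t0 tT; rewrite Xin// !ltW.
  have dX' : differentiable X t by apply/derivable1_diffP.
  have dbXt : differentiable (b \o X) t by apply: differentiable_comp.
  have : 0 < 'D_1 (b \o X) t.
    (* The chain rule turns the derivative along the curve into the gradient applied to [v t]. *)
    rewrite deriveE// diff_comp//= -(deriveE _ dX') DX diff_grad// zt.
    by apply: bv => //; rewrite -zt.
  move/near_right_lt_of_derive_gt0 => H; near=> s; apply: ltW; near: s; apply: H.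
  exact: diff_derivable.
Unshelve. all: by end_near. Qed.

Theorem lemma7 (R : realType) (n p q r m : nat)
    (f : 'cV[R]_n -> 'cV[R]_n) (g : 'cV[R]_n -> 'M[R]_(n, p))
    (c : 'M[R]_(q, n)) (h : 'cV[R]_n -> R) (alpha : R -> R)
    (L : 'I_m -> 'M[R]_p) (hd : 'I_m -> nat -> 'cV[R]_n -> R)
    (d' : 'I_m -> nat) (k : 'I_m)
    (u : R -> 'cV[R]_p) (x : R -> 'cV[R]_n) (y : R -> 'cV[R]_q) :
  [locally [lipschitz f z | z in [set: 'cV[R]_n]]] ->
  [locally [lipschitz g z | z in [set: 'cV[R]_n]]] ->
  (forall z, superlevel h z -> twice_differentiable h z) ->
  class_K alpha ->
  range L = failure_patterns p r ->
  actuator_redundancy f g r ->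
  (forall j, high_order_functions f g (L j) h (d' j) (hd j)) ->
  (forall T, 0 <= T -> trajectory f g c (L k) T u x y) ->
  (forall j t, 0 <= t -> relative_degree g (L j) (hd j) (d' j) (x t)) ->
  (\bigcap_(j in [set: 'I_m])
     \bigcap_(d in [set d : nat | (d <= d' j)%N]) superlevel (hd j d)) (x 0) ->
  (forall t, 0 <= t ->
     \bigcap_(j in [set: 'I_m]) Omega f g (L j) alpha (hd j (d' j)) (x t)
       !=set0) ->
  (forall t, 0 <= t ->
     (\bigcap_(j in [set: 'I_m])
        Omega f g (L j) alpha (hd j (d' j)) (x t)) (u t)) ->
  forall t, 0 <= t -> superlevel h (x t).
Proof.
move=> _ _ _ [_ alpha_lt alpha0] _ _ hoh traj reldeg x0 _ uOmega.
have [hd0 hdS] := hoh k.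
have dhd d t : (d <= d' k)%N -> 0 <= t -> differentiable (hd k d) (x t).
  by move=> dk t0; have [+ _ _] := reldeg k t t0; exact.
have invariant d : (d <= d' k)%N ->
    (forall t, 0 <= t -> hd k d (x t) < 0 ->
       0 < (grad (hd k d) (x t) *m vfield f g (L k) (x t) (u t)) 0 0) ->
    forall t, 0 <= t -> 0 <= hd k d (x t).
  move=> dk flow t t0; have [xt _] := traj t t0.
  apply: (superlevel_forward_invariant t0 xt).
  - by move=> s /andP[s0 _]; exact: dhd.
  - by move=> s /andP[/ltW s0 _]; exact: flow.
  - exact: x0.
(* The descending induction is run upwards on [e], the distance from the top order [d' k];
   [e = d' k] is [h] itself. *)
suff hd_ge0 e : (e <= d' k)%N ->
    forall t, 0 <= t -> 0 <= hd k (d' k - e)%N (x t).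
  by move=> t t0; rewrite /superlevel /= -hd0 -(subnn (d' k)); exact: hd_ge0.
elim: e => [_|e IHe ek].
  (* At a negative value, strict monotonicity and [alpha 0 = 0] make the lower bound in [Omega]
     positive. *)
  rewrite subn0; apply: invariant => // t t0 ht.
  apply: lt_le_trans (uOmega t t0 k I).
  by rewrite oppr_gt0 -alpha0 alpha_lt.
have ltk : (d' k - e.+1 < d' k)%N by rewrite ltn_subrL (leq_ltn_trans _ ek).
apply: invariant => [|t t0 ht]; first exact: leq_subr.
have := IHe (ltnW ek) t t0.
(* The recursion is instantiated at the applied input [u t], so its gradient term is the actual
   derivative along the flow. *)
rewrite -(subnSK ek) (hdS _ ltk _ (dhd _ _ (ltnW ltk) t0) (u t)); lra.
Qed.
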